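(* Let $F$ satisfy the range invariance condition $F(x)-F(x_0)=K\,r(x)$ for all $x\in U$, with $K\in L(\widetilde X,Y)$ and with $r:U\to\widetilde X$ Lipschitz continuous; let $(I-P)(X)\subseteq\check X$ and $P(x^\dagger)=P(x_0)=0$. Let the variational source condition (VSC) stated in the context hold with $\psi$ satisfying conditions (a), (b), (c) of the context. Assume that the functionals $\mathcal{R}:\widetilde X\to[0,\infty]$ and $\mathcal{Q}:\widetilde X^2\to[0,\infty]$ satisfy $$\mathcal{R}(\hat r)=\check{\mathcal{R}}\big((I-P)(r^{-1}(\hat r))\big),\qquad \|P(r^{-1}(\hat r_1))-P(r^{-1}(\hat r_2))\|_X\le C_Q\,\mathcal{Q}(\hat r_1,\hat r_2)\quad\forall \hat r_1,\hat r_2,$$ for some constant $C_Q>0$. Let $\beta>0$ be a fixed constant, and let $C_\eta>0$, $0<\underline\tau<\overline\tau$ be fixed. Then, for every sufficiently large constant $\bar C>0$ (i.e. there is $\bar C_0>0$ such that for every $\bar C\ge\bar C_0$), the following holds. For any family of data $(y^\delta)_{\delta\in(0,\bar\delta]}$ with $\|y-y^\delta\|_Y\le\delta$ and parameters $\alpha=\alpha(\delta)>0$, $\eta=\eta(\delta)>0$ satisfying $$\eta\le C_\eta\delta^p,\qquad \underline\tau\delta^p\le\varphi^{-1}(\alpha):=\alpha\,(-\psi)^*\Big(-\frac{1}{2\bar C\alpha}\Big)\le\overline\tau\delta^p,$$ any family $(\hat r^\delta_{\alpha,\beta,\eta},x^\delta_{\alpha,\beta,\eta})\in\widetilde X\times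 U$ satisfying $$J^\delta_{\alpha,\beta}(\hat r^\delta_{\alpha,\beta,\eta},x^\delta_{\alpha,\beta,\eta})\le J^\delta_{\alpha,\beta}(\hat r,x)+\eta\qquad\forall(\hat r,x)\in\widetilde X\times U,$$ where $$J^\delta_{\alpha,\beta}(\hat r,x)=\|K\hat r+F(x_0)-y^\delta\|_Y^p+\alpha\mathcal{R}(\hat r)+\beta\,\mathcal{Q}(r(x),\hat r)^p+\|P(x)\|_X^p,$$ satisfies, as $\delta\to0$, $$\Delta^{\check{\mathcal{R}}}_{\check\xi}\big((I-P)(r^{-1}(\hat r^\delta_{\alpha,\beta,\eta})),x^\dagger\big)=O(\widetilde\psi(\delta^p)),\qquad \|K(\hat r^\delta_{\alpha,\beta,\eta}-r(x^\dagger))\|_Y=O(\delta),$$ $$\|P(x^\delta_{\alpha,\beta,\eta})\|=O(\delta),\qquad \mathcal{Q}(r(x^\delta_{\alpha,\beta,\eta}),\hat r^\delta_{\alpha,\beta,\eta})=O(\delta),$$ where $$\widetilde\psi(d)=(-\psi)^*\Big(-\frac{1}{2\bar C\,\varphi(\overline\tau d)}\Big),\qquad \varphi^{-1}(t)=t\,(-\psi)^*\Big(-\frac{1}{2\bar C t}\Big).$$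
   Context: Setting. $X,\widetilde X,Y$ are Banach spaces, $p\in[1,\infty)$, $F:\mathcal{D}(F)(\subseteq X)\to Y$, $U\subseteq\mathcal{D}(F)$, and $x^\dagger\in U$ is an exact solution, $F(x^\dagger)=y$. Range invariance: there exist $x_0\in U$ and $K\in L(\widetilde X,Y)$ such that for every $x\in U$ there is $r(x)\in\widetilde X$ with $F(x)-F(x_0)=Kr(x)$. The map $r$ is injective on $U$ with inverse $r^{-1}:r(U)\to U$; conditions involving $r^{-1}(\hat r)$ are understood for $\hat r\in r(U)$, and $\mathcal{R}(\hat r)=+\infty$ for $\hat r\notin r(U)$. $P:X\to X$ is an operator, $\check X$ is a subspace of $X$ with $P|_{\check X}=0$, and $I$ is the identity. $\mathcal{Q}$ is such that $\mathcal{Q}(\hat r_1,\hat r_2)=0$ if and only if $\hat r_1=\hat r_2$. $\check{\mathcal{R}}:\check X\to[0,\infty]$ is a proper functional. Subdifferential: $\partial f(x)=\{\xi: \langle\xi,\tilde x-x\rangle\le f(\tilde x)-f(x)\ \forall\tilde x\in\mathrm{dom}(f)\}$. Bregman distance: $\Delta^f_{\xi_2}(x_1,x_2)=f(x_1)-f(x_2)-\langle\xi_2,x_1-x_2\rangle$ for $\xi_2\in\partial f(x_2)$. VSC: $\check F$ denotes the restriction of $F$ to $\check X$, i.e. $\check F(\check x)=F(\check x)=Kr(\check x)+F(x_0)$. For some $b\in(0,1)$ and some $\overline R\ge\check{\mathcal{R}}(x^\dagger)$ there exists $\check\xi\in\partial\check{\mathcal{R}}(x^\dagger)\subseteq\check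 X^*$ such that for all $\check x\in\check X$ with $\check{\mathcal{R}}(\check x)\le\overline R$ (all of which are understood to lie in the domain $U$), $$-\langle\check\xi,\check x-x^\dagger\rangle\le b\,\Delta^{\check{\mathcal{R}}}_{\check\xi}(\check x,x^\dagger)+\psi\big(\|\check F(\check x)-\check F(x^\dagger)\|^p\big).$$ Conditions on $\psi$. An index function is a continuous monotonically increasing function $[0,\infty)\to[0,\infty)$ vanishing at $0$. (a) $\psi$ is an index function. (b) $\psi(t)\ge c_\psi t$ for all $t>0$, for some $c_\psi>0$. (c) Extending $\psi$ by $-\infty$ for $t<0$: $-\psi$ is convex, $t\mapsto(-\psi)^*(-1/t)$ (extended by $0$ at $t=0$) is an index function, and $t\mapsto t\,(-\psi)^*(-1/t)$ is strictly monotone. Here $f^*(s)=\sup_{t\in\mathbb{R}}(st-f(t))$ is the convex conjugate.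
   Formalization: The VSC is assumed with R̄ strictly above Ř(x†), since with equality the Bregman rate can fail; in (c) the conjugate may take the value +∞, with strict monotonicity required only where finite, because (b) contradicts (c) read with finite values. *)

(* Defs.v *)
From HB Require Import structures.
From mathcomp Require Import all_boot all_order all_algebra.
From mathcomp Require Import all_classical all_reals all_analysis.

Set Implicit Arguments.
Unset Strict Implicit.
Unset Printing Implicit Defensive.

Import Order.TTheory GRing.Theory Num.Theory.
Import numFieldNormedType.Exports.

Local Open Scope classical_set_scope.
Local Open Scope ring_scope.
Local Open Scope ereal_scope.

Section FunctionalsOnSubspace.
Context {R : realType} {X : normedModType R}.

(* A functional on a subspace V of X, or an element of the dual V^*, is
   represented by a function on all of X; its values outside V are never
   used. *)

Implicit Types (V : set X) (f : X -> \bar R) (xi : X -> R).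

Definition proper_on V f : Prop :=
  (forall x, V x -> -oo < f x) /\ (exists2 x, V x & f x < +oo).

Definition dual_on V xi : Prop :=
  (forall (a : R) (u v : X), V u -> V v ->
     xi (a *: u + v)%R = (a * xi u + xi v)%R) /\
  (exists M : R, forall u, V u -> (`|xi u| <= M * `|u|)%R).

Definition subdifferential_on V f (x : X) : set (X -> R) :=
  [set xi | dual_on V xi /\
    forall z, V z -> f z < +oo -> (xi (z - x)%R)%:E <= f z - f x].

Definition bregman f xi (x1 x2 : X) : \bar R :=
  f x1 - f x2 - (xi (x1 - x2)%R)%:E.

End FunctionalsOnSubspace.

Section IndexFunctions.
Context {R : realType}.
Implicit Types (f : R -> \bar R) (psi : R -> R) (C t s d : R).

(* Values in [0, +oo] are allowed: if psi t >= c * t for all t > 0, then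
   (-psi)^*(-1/t) = +oo for t > 1/c, so psistar psi below cannot be finite on
   all of [0, +oo[.  An index function psi in the usual sense is real-valued,
   i.e. index_function (fun t => (psi t)%:E).  Nonnegativity on [0, +oo[
   follows from f 0 = 0 and monotonicity. *)
Definition index_function f : Prop :=
  [/\ f 0%R = 0,
      forall s t, (0 <= s)%R -> (s <= t)%R -> f s <= f t &
      {within `[0%R, +oo[, continuous f}].

Definition econvex f : Prop :=
  forall s t l, (0 < l)%R -> (l < 1)%R ->
    f ((1 - l) * s + l * t)%R <= (1 - l)%:E * f s + l%:E * f t.

Definition conjugate f s : \bar R :=
  ereal_sup (range (fun t => (s * t)%:E - f t)).

(* -psi, where psi is extended by -oo to the negative half-line *)
Definition oppext psi t : \bar R := if (0 <= t)%R then (- psi t)%:E else +oo.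

Definition psistar psi t : \bar R :=
  if t == 0%R then 0 else conjugate (oppext psi) (- (1 / t))%R.

(* The product in the last clause is required to increase strictly as long as
   it is finite. *)
Definition conjugate_condition psi : Prop :=
  [/\ econvex (oppext psi),
      index_function (psistar psi) &
      forall s t, (0 <= s)%R -> (s < t)%R -> s%:E * psistar psi s < +oo ->
        s%:E * psistar psi s < t%:E * psistar psi t].

Definition phi_inv psi C t : \bar R :=
  t%:E * conjugate (oppext psi) (- (1 / (2 * C * t)))%R.

(* The inverse on [0, +oo[ of phi_inv; arbitrary outside its range. *)
Definition phi psi C s : R := pinv (`[0%R, +oo[%classic : set R) (phi_inv psi C) s%:E.

Definition psi_tilde psi C tau d : \bar R :=
  conjugate (oppext psi) (- (1 / (2 * C * phi psi C (tau * d))))%R.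

Definition ebigO (F : set_system R) f (g : R -> \bar R) : Prop :=
  exists C, \forall x \near F, `|f x| <= C%:E * `|g x|.

End IndexFunctions.

Section Problem.
Context {R : realType} {X Xt Y : normedModType R}.

(* Only the values of F at points of Xc are used.  The bound Rbar lies strictly
   above Rc xdag: regularized solutions approach the value Rc xdag of Rc but may
   stay above it, and if the sublevel set were bounded by Rc xdag itself, the
   condition would say nothing about them. *)
Definition VSC (Xc U : set X) (F : X -> Y) (Rc : X -> \bar R) (xdag : X)
    (psi : R -> R) (p b Rbar : R) (xi : X -> R) : Prop :=
  [/\ (0 < b < 1)%R,
      Rc xdag < Rbar%:E,
      subdifferential_on Xc Rc xdag xi &
      forall x, Xc x -> Rc x <= Rbar%:E ->
        U x /\
        (- xi (x - xdag))%:E <=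
          b%:E * bregman Rc xi x xdag + (psi (`|F x - F xdag| `^ p))%:E].

Definition tikhonov (K : Xt -> Y) (Fx0 ydelta : Y) (Reg : Xt -> \bar R)
    (Q : Xt -> Xt -> \bar R) (P : X -> X) (r : X -> Xt) (p alpha beta : R)
    (rhat : Xt) (x : X) : \bar R :=
  (`|K rhat + Fx0 - ydelta| `^ p)%:E + alpha%:E * Reg rhat
    + beta%:E * Q (r x) rhat `^ p + (`|P x| `^ p)%:E.

End Problem.

(* Main.v *)
Require Import Defs.
From HB Require Import structures.
From mathcomp Require Import all_boot all_order all_algebra.
From mathcomp Require Import all_classical all_reals all_analysis.
From mathcomp Require Import lra ring.
Import Order.TTheory GRing.Theory Num.Theory.
Import numFieldNormedType.Exports.
Local Open Scope classical_set_scope.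
Local Open Scope ring_scope.
Local Open Scope ereal_scope.

(** Why the rates hold.  Write T for the sum of the p-th powers of the residual
    [K rhat + F x0 - ydelta], of Q (weighted by beta) and of [P x], and let D
    be the Bregman distance of u - P u to xdag, where rhat = r u.

    Comparing the near-minimizer with the exact pair (r xdag, xdag), at which Q
    and P vanish, gives T + alpha (Rc (u - P u) - Rc xdag) = O(d ^ p).  The
    source condition bounds the difference of the Rc values from below by
    (1 - b) D - psi (N ^ p), where N is the norm of F (u - P u) - F xdag.
    Although u - P u is not itself a near-minimizer, N is controlled by T: range
    invariance turns F (u - P u) - F u into K (r (u - P u) - r u), and
    continuity of K, the Lipschitz bound on r and the bound on P by Q give
    N ^ p <= c ^ p (T + d ^ p) for a constant c ([defect_powR_bound]).

    Young's inequality at slope 1 / (2 Cbar alpha) then gives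
    alpha psi (N ^ p) <= N ^ p / (2 Cbar) + alpha (-psi)^*(-1 / (2 Cbar alpha)).
    The last term is [phi_inv] at alpha, which the choice of alpha makes
    O(d ^ p), and the first is at most (T + d ^ p) / 2 as soon as
    Cbar >= c ^ p: this is why Cbar must be large, and T on the left absorbs
    it ([absorb]).  Hence T + alpha D = O(d ^ p), which contains the last three
    rates ([near_minimizer_estimate]).

    For the first rate, d ^ p <= phi_inv alpha / taul turns alpha D = O(d ^ p)
    into D = O((-psi)^*(-1 / (2 Cbar alpha))), and alpha is at most
    phi (tauu d ^ p) because phi_inv increases ([le_phi]); this step needs
    phi to be a genuine inverse of phi_inv near 0, which is the intermediate
    value theorem ([phi_inv_range]).

    The source condition applies only on the sublevel set of Rbar.  As d tends
    to 0, phi_inv alpha tends to 0, hence so do alpha and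
    (-psi)^*(-1 / (2 Cbar alpha)) ([psistar_small_of_phi_inv]), and the latter
    dominates Rc (u - P u) - Rc xdag up to a constant factor. *)

Set Implicit Arguments.
Unset Strict Implicit.
Unset Printing Implicit Defensive.

(** * The conjugate of -psi and the parameter choice *)

Section ConjugateCalculus.
Context {R : realType} (psi : R -> R).

(** The Fenchel-Young inequality for -psi at the slope -1/t. *)
Lemma young_conjugate (s t : R) : (0 <= s)%R ->
  (psi s)%:E <= (s / t)%:E + conjugate (oppext psi) (- (1 / t))%R.
Proof.
move=> s0; rewrite addeC -leeBlDr//; apply: ereal_sup_ubound.
exists s => //; rewrite /oppext s0 -EFinB -EFinB; congr (_%:E); ring.
Qed.

Context (hpsi : conjugate_condition psi).

Lemma psistar_le (s t : R) : (0 <= s)%R -> (s <= t)%R ->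
  psistar psi s <= psistar psi t.
Proof. by case: hpsi => _ [_ + _] _; apply. Qed.

Lemma psistar_ge0 (t : R) : (0 <= t)%R -> 0 <= psistar psi t.
Proof.
move=> t0; case: hpsi => _ [<- _ _] _; exact: psistar_le.
Qed.

Lemma psistar_cvg (t : R) : (0 <= t)%R ->
  psistar psi s @[s --> within `[0%R, +oo[ (nbhs t)] --> psistar psi t.
Proof.
move=> t0; case: hpsi => _ [_ _ /subspace_continuousP +] _; apply.
by rewrite /= in_itv /= t0.
Qed.

Lemma psistar_cvg0 : psistar psi t @[t --> 0^'+] --> 0.
Proof.
case: (hpsi) => _ [h0 _ _] _; rewrite -[X in _ --> X]h0.
apply: cvg_trans (psistar_cvg (lexx 0%R)) => A.
rewrite /within /nbhs /=; apply: filterS => t + /ltW t0; apply.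
by rewrite /= in_itv /= t0.
Qed.

Lemma psistar_small (e : R) : (0 < e)%R ->
  exists2 t : R, (0 < t)%R & psistar psi t < e%:E.
Proof.
move=> e0; near (0%R : R)^'+ => t; exists t.
  by near: t; exact: nbhs_right_gt.
rewrite -[psistar psi t]fineK; last by near: t; exact: cvg_is_fine psistar_cvg0.
rewrite lte_fin; near: t.
exact: (cvgr_lt 0%R (fine_cvg psistar_cvg0) e e0).
Unshelve. all: by end_near. Qed.

Lemma conjugateE (t : R) : (0 < t)%R ->
  conjugate (oppext psi) (- (1 / t))%R = psistar psi t.
Proof. by move=> t0; rewrite /psistar gt_eqF. Qed.

Lemma phi_invE (C t : R) : (0 < C)%R -> (0 < t)%R ->
  phi_inv psi C t = t%:E * psistar psi (2 * C * t).
Proof.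
move=> C0 t0; rewrite /phi_inv /psistar ifF//.
by apply/negbTE; rewrite !mulf_neq0// gt_eqF.
Qed.

(** Up to the factor 2C, [phi_inv] is the product whose strict monotonicity is
    assumed in [conjugate_condition].  At t = 0, where [psistar] and the
    conjugate need not agree, both sides carry a zero factor. *)
Lemma phi_inv_scale (C t : R) : (0 < C)%R -> (0 <= t)%R ->
  (2 * C)%:E * phi_inv psi C t = (2 * C * t)%:E * psistar psi (2 * C * t).
Proof.
move=> C0; rewrite le_eqVlt => /predU1P[<-|t0].
  by rewrite /phi_inv mulr0 !mul0e mule0.
by rewrite phi_invE// muleA EFinM.
Qed.

Lemma phi_inv_lt (C s t : R) : (0 < C)%R -> (0 <= s)%R -> (s < t)%R ->
  phi_inv psi C s < +oo -> phi_inv psi C s < phi_inv psi C t.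
Proof.
move=> C0 s0 st sfin; have C20 : (0 < 2 * C)%R by rewrite mulr_gt0.
rewrite -(@lte_pmul2l _ (2 * C)%:E)// ?lte_fin//.
rewrite !phi_inv_scale//; last by rewrite (le_trans s0)// ltW.
case: hpsi => _ _; apply; first by rewrite mulr_ge0// ltW.
  by rewrite ltr_pM2l.
by rewrite -phi_inv_scale// lte_mul_pinfty// ?lee_fin// ltW.
Qed.

Lemma phi_inv0 (C : R) : phi_inv psi C 0 = 0.
Proof. by rewrite /phi_inv mul0e. Qed.

Lemma phi_inv_le (C s t : R) : (0 < C)%R -> (0 <= s)%R -> (s <= t)%R ->
  phi_inv psi C s <= phi_inv psi C t.
Proof.
move=> C0 s0 st; have C20 : (0 < 2 * C)%R by rewrite mulr_gt0.
have t0 := le_trans s0 st.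
rewrite -(@lee_pmul2l _ (2 * C)%:E)// ?lte_fin// !phi_inv_scale//.
by rewrite lee_pmul ?lee_fin ?psistar_ge0 ?psistar_le ?mulr_ge0 ?ler_pM2l// ltW.
Qed.

(** By strict monotonicity phi_inv e > 0, so a small value of [phi_inv] can only
    be taken at a small argument. *)
Lemma phi_inv_small (C e : R) : (0 < C)%R -> (0 < e)%R ->
  exists2 m : R, (0 < m)%R &
  forall t, (0 <= t)%R -> phi_inv psi C t < m%:E -> (t < e)%R.
Proof.
move=> C0 e0.
have e_gt0 : 0 < phi_inv psi C e.
  by rewrite -(phi_inv0 C) phi_inv_lt// phi_inv0 ltry.
have [m m0 me] : exists2 m : R, (0 < m)%R & m%:E <= phi_inv psi C e.
  (* phi_inv e may be infinite, and any positive m then serves *)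
  case: (phi_inv psi C e) e_gt0 => [m|_|//]; last by exists 1%R; rewrite ?leey.
  by rewrite lte_fin => m0; exists m.
exists m => // t t0 tm; rewrite ltNge; apply/negP => et.
by have := lt_le_trans tm (le_trans me (phi_inv_le C0 (ltW e0) et)); rewrite ltxx.
Qed.

(** The choice of alpha prescribes only the size of phi_inv alpha; this is what
    makes the conjugate term vanish in the limit. *)
Lemma psistar_small_of_phi_inv (C e : R) : (0 < C)%R -> (0 < e)%R ->
  exists2 m : R, (0 < m)%R &
  forall t, (0 < t)%R -> phi_inv psi C t < m%:E -> psistar psi (2 * C * t) < e%:E.
Proof.
move=> C0 e0; have C20 : (0 < 2 * C)%R by rewrite mulr_gt0.
have [u u0 ue] := psistar_small e0.
have [m m0 small] := phi_inv_small C0 (divr_gt0 u0 C20).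
exists m => // t t0 /(small _ (ltW t0)).
rewrite ltr_pdivlMr// mulrC => tu; apply: le_lt_trans ue.
by apply: psistar_le; [rewrite mulr_ge0// ltW|exact: ltW].
Qed.

(** [psistar] is finite and continuous on some interval [0, u], so the
    intermediate value theorem applies to the real function s * psistar s
    there; beyond u infinite values may occur, hence only small v are reached. *)
Lemma phi_inv_range (C : R) : (0 < C)%R ->
  exists2 m : R, (0 < m)%R &
  forall v, (0 <= v <= m)%R -> exists2 t, (0 <= t)%R & phi_inv psi C t = v%:E.
Proof.
move=> C0; have C20 : (0 < 2 * C)%R by rewrite mulr_gt0.
have [u u0 ufin] := psistar_small ltr01.
have sfin s : (0 <= s <= u)%R -> psistar psi s \is a fin_num.
  move=> /andP[s0 su]; rewrite ge0_fin_numE ?psistar_ge0//.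
  by rewrite (le_lt_trans (psistar_le s0 su))// (lt_trans ufin)// ltry.
pose g (s : R) := (s * fine (psistar psi s))%R.
have gE s : (0 <= s <= u)%R -> (g s)%:E = s%:E * psistar psi s.
  by move=> su; rewrite /g EFinM fineK// sfin.
have gcont : {within `[0%R, u], continuous g}.
  apply/subspace_continuousP => s /=; rewrite in_itv /= => /andP[s0 su].
  apply: cvgM; first exact: cvg_within.
  apply: fine_cvg; rewrite fineK ?sfin ?s0//.
  apply: cvg_trans (psistar_cvg s0) => A.
  rewrite /within /nbhs /=; apply: filterS => t + tu; apply.
  by move: tu; rewrite /= !in_itv /= => /andP[->].
have g0 : g 0%R = 0%R by rewrite /g mul0r.
have gu : (0 < g u)%R.
  rewrite -lte_fin -{1}g0 !gE ?lexx ?(ltW u0)//.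
  case: hpsi => _ _; apply => //; by rewrite mul0e ltry.
exists (g u / (2 * C))%R; first by rewrite divr_gt0.
move=> v /andP[v0 vm].
have [|s] := @IVT _ g 0%R u (2 * C * v)%R (ltW u0) gcont.
  have vu : (2 * C * v <= g u)%R by rewrite mulrC -ler_pdivlMr.
  by rewrite g0 ge_min le_max mulr_ge0 ?(ltW C20)//= vu orbT.
rewrite in_itv /= => su gs; have /andP[s0 _] := su.
exists (s / (2 * C))%R; first by rewrite divr_ge0// ltW.
have := phi_inv_scale C0 (divr_ge0 s0 (ltW C20)).
rewrite (mulrC (2 * C)%R (s / _)%R) divfK ?gt_eqF// -gE// gs.
move=> /(congr1 (fun x => ((2 * C)^-1)%:E * x)).
by rewrite muleA -!EFinM mulVf ?gt_eqF// mul1e mulKf ?gt_eqF.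
Qed.

(** [phi] is a pseudo-inverse, arbitrary off the range of [phi_inv]; on the small
    values provided by [phi_inv_range] it is an inverse, and then strict
    monotonicity turns phi_inv t <= v into t <= phi v. *)
Lemma le_phi (C : R) : (0 < C)%R ->
  exists2 m : R, (0 < m)%R &
  forall v t, (0 <= v <= m)%R -> (0 <= t)%R ->
    phi_inv psi C t <= v%:E -> (t <= phi psi C v)%R.
Proof.
move=> C0; have [m m0 range] := phi_inv_range C0; exists m => // v t vm t0 tv.
have vim : (phi_inv psi C @` `[0%R, +oo[%classic) v%:E.
  have [s s0 <-] := range v vm; exists s => //=.
  by rewrite in_itv /= s0.
have phiK : phi_inv psi C (phi psi C v) = v%:E.
  by apply: pinvK; rewrite inE.
have phi0 : (0 <= phi psi C v)%R.
  have : `[0%R, +oo[%classic (phi psi C v).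
    have surj : set_surj `[0%R, +oo[%classic
      (phi_inv psi C @` `[0%R, +oo[%classic) (phi_inv psi C) by [].
    have sub := @surjpinv_image_sub _ _ (fun=> point) _ _ _ surj.
    by apply: sub; exists v%:E.
  by rewrite /= in_itv /= andbT.
rewrite leNgt; apply/negP => lt_phi.
have : phi_inv psi C (phi psi C v) < phi_inv psi C t.
  by apply: phi_inv_lt => //; rewrite phiK ltry.
by rewrite phiK ltNge tv.
Qed.

End ConjugateCalculus.

(** * Powers and boundedness constants *)

Lemma le_powR_inv (R : realType) (p x t : R) : (0 < p)%R -> (0 <= x)%R ->
  (x `^ p <= t)%R -> (x <= t `^ p^-1)%R.
Proof.
move=> p0 x0 xt; rewrite -[leLHS](powRr1 x0) -(mulfV (lt0r_neq0 p0)) powRrM.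
have t0 := le_trans (powR_ge0 x p) xt.
by rewrite ge0_ler_powR ?nnegrE ?powR_ge0// invr_ge0 ltW.
Qed.

(** The quantities are compared with one number s, the p-th root of their power
    sum.  A linear expression in them is thus bounded by a multiple of s, and
    taking its p-th power needs no inequality for powers of sums. *)
Lemma le_powR_sum (R : realType) (p beta res q m d : R) :
  (0 < p)%R -> (0 < beta)%R ->
  (0 <= res)%R -> (0 <= q)%R -> (0 <= m)%R -> (0 <= d)%R ->
  let s := ((res `^ p + beta * q `^ p + m `^ p + d `^ p) `^ p^-1)%R in
  [/\ (res <= s)%R, (q <= beta^-1 `^ p^-1 * s)%R, (m <= s)%R & (d <= s)%R].
Proof.
move=> p0 b0 res0 q0 m0 d0 /=.
have [resp mp dp] : [/\ 0 <= res `^ p, 0 <= m `^ p & 0 <= d `^ p]%R.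
  by rewrite !powR_ge0.
have qp : (0 <= beta * q `^ p)%R by rewrite mulr_ge0 ?powR_ge0// ltW.
split; try by apply: le_powR_inv => //; lra.
rewrite -powRM; [|by rewrite invr_ge0 ltW|lra].
by apply: le_powR_inv => //; rewrite ler_pdivlMl//; lra.
Qed.

Lemma powR_invK (R : realType) (p t : R) : (0 < p)%R -> (0 <= t)%R ->
  ((t `^ p^-1) `^ p = t)%R.
Proof. by move=> p0 t0; rewrite -powRrM mulVf ?gt_eqF// powRr1. Qed.

Lemma near_powR_lt (R : realType) (p tau m : R) : (0 < p)%R -> (0 < m)%R ->
  \forall d \near (0%R : R)^'+, (tau * d `^ p < m)%R.
Proof.
move=> p0 m0.
have h : (tau * d `^ p)%R @[d --> (0%R : R)^'+] --> (tau * 0)%R.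
  by apply: cvgMr; exact: powR_cvg0.
by rewrite mulr0 in h; exact: (cvgr_lt 0%R h m m0).
Qed.

Lemma lipschitz_ex_gt0 (R : realType) (V W : normedModType R) (f : V -> W)
    (A : set V) : [lipschitz f x | x in A] ->
  exists2 L : R, (0 < L)%R &
  forall u v, A u -> A v -> (`|f u - f v| <= L * `|u - v|)%R.
Proof.
move=> /pinfty_ex_gt0[L L0 HL]; exists L => // u v Au Av.
by apply: (HL (u, v)).
Qed.

Lemma linear_bound_ex_gt0 (R : realType) (V W : normedModType R)
    (K : {linear V -> W}) : continuous K ->
  exists2 k : R, (0 < k)%R & forall v, (`|K v| <= k * `|v|)%R.
Proof.
by move=> /linear_bounded_continuous/linear_boundedP/pinfty_ex_gt0.
Qed.

(** * Ingredients of the error estimate *)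

(** A bound on the functional forces each term to be finite, so that the rest of
    the argument can be carried out in real numbers. *)
Lemma tikhonov_finite (R : realType) (X Xt Y : normedModType R)
    (K : Xt -> Y) (Fx0 yd : Y) (Reg : Xt -> \bar R) (Q : Xt -> Xt -> \bar R)
    (P : X -> X) (r : X -> Xt) (p alpha beta B : R) (rh : Xt) (x : X) :
  (0 < p)%R -> (0 < alpha)%R -> (0 < beta)%R ->
  0 <= Reg rh -> 0 <= Q (r x) rh ->
  tikhonov K Fx0 yd Reg Q P r p alpha beta rh x <= B%:E ->
  exists rho q : R, [/\ Reg rh = rho%:E, (0 <= rho)%R,
    Q (r x) rh = q%:E, (0 <= q)%R &
    (`|K rh + Fx0 - yd| `^ p + alpha * rho + beta * q `^ p + `|P x| `^ p
       <= B)%R].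
Proof.
move=> p0 a0 b0; rewrite /tikhonov.
case: (Reg rh) => [rho rho0||//]; last first.
  move=> _ Q0; rewrite gt0_muley ?lte_fin// addey// addye.
    by rewrite addye ?leye_eq.
  by rewrite gt_eqF// (lt_le_trans (ltNyr 0))// mule_ge0 ?lee_fin ?poweR_ge0// ltW.
case: (Q (r x) rh) => [q q0||//]; last first.
  by move=> _; rewrite poweRyr ?gt_eqF// gt0_muley ?lte_fin// addey// addye ?leye_eq.
rewrite poweR_EFin -!EFinM -!EFinD lee_fin => le_B.
by exists rho, q; split.
Qed.

(** Since D is the difference of the Rc values minus the dual pairing, the bound
    of minus the pairing by b D + psi leaves a multiple 1 - b of D, which is
    positive because b < 1. *)
Lemma VSC_bregman (R : realType) (X Y : normedModType R) (Xc U : set X)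
    (F : X -> Y) (Rc : X -> \bar R) (xdag : X) (psi : R -> R) (p b Rbar : R)
    (xi : X -> R) (x : X) (rho rho0 : R) :
  VSC Xc U F Rc xdag psi p b Rbar xi -> Xc x ->
  Rc x = rho%:E -> Rc xdag = rho0%:E -> (rho <= Rbar)%R ->
  exists D, [/\ bregman Rc xi x xdag = D%:E, (0 <= D)%R, U x &
    ((1 - b) * D <= rho - rho0 + psi (`|F x - F xdag| `^ p))%R].
Proof.
move=> [_ _ [_ sub] vsc] Xcx Rx Rxd rhoR.
have [Ux] := vsc x Xcx ltac:(by rewrite Rx lee_fin).
have /(_ Xcx) := sub x; rewrite /bregman Rx Rxd ltry => /(_ isT).
rewrite -!EFinB -EFinM -EFinD !lee_fin => h1 h2.
by exists (rho - rho0 - xi (x - xdag))%R; split => //; lra.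
Qed.

(** The bootstrap inequality.  T is the sum of the penalties, dp = d ^ p, drho the
    difference of the Rc values, D the Bregman distance, N the p-th power of the
    defect and S the conjugate term; C >= C1 makes N / (2C) at most
    (T + dp) / 2, which T on the left absorbs. *)
Lemma absorb (R : realType) (T dp alpha drho D psiN N S C1 C b Ceta tauu : R) :
  (0 < alpha)%R -> (0 < C1)%R -> (C1 <= C)%R -> (0 <= T)%R -> (0 <= dp)%R ->
  (T + alpha * drho <= (1 + Ceta) * dp)%R ->
  ((1 - b) * D <= drho + psiN)%R ->
  (psiN <= N / (2 * C * alpha) + S)%R ->
  (N <= C1 * (T + dp))%R ->
  (alpha * S <= tauu * dp)%R ->
  (T / 2 + alpha * ((1 - b) * D) <= (3 / 2 + Ceta + tauu) * dp)%R.
Proof.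
move=> a0 C10 C1C T0 dp0 hT hD hpsi hN hS.
have C0 := lt_le_trans C10 C1C.
have hNC : (N / (2 * C) <= (T + dp) / 2)%R.
  rewrite ler_pdivrMr ?mulr_gt0//.
  apply: (le_trans hN); rewrite (_ : _ / 2 * _ = C * (T + dp))%R; last by field.
  by rewrite ler_wpM2r ?addr_ge0.
have : (alpha * ((1 - b) * D) <= alpha * drho + (N / (2 * C) + alpha * S))%R.
  rewrite (_ : N / (2 * C) = alpha * (N / (2 * C * alpha)))%R; last first.
    by field; rewrite !gt_eqF.
  by rewrite -!mulrDr ler_pM2l// (le_trans hD)// lerD2l.
lra.
Qed.

(** The defect is at most res + d + k L (CQ q + m) (see [defect_bound]), and by
    [le_powR_sum] each of res, m, d is at most s and q at most beta^(-1/p) s. *)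
Definition defect_const {R : realType} (p beta CQ k L : R) : R :=
  (2 + k * L * (CQ * beta^-1 `^ p^-1 + 1))%R.

Lemma defect_const_gt0 (R : realType) (p beta CQ k L : R) :
  (0 < CQ)%R -> (0 < k)%R -> (0 < L)%R -> (0 < defect_const p beta CQ k L)%R.
Proof.
move=> CQ0 k0 L0; rewrite ltr_wpDr// mulr_ge0 ?mulr_ge0 ?(ltW k0) ?(ltW L0)//.
by rewrite addr_ge0// mulr_ge0 ?powR_ge0// ltW.
Qed.

(** * The estimate at a fixed noise level *)

Section Estimate.
Context {R : realType} {X Xt Y : normedModType R} (p : R) (hp : (1 <= p)%R)
  (U : set X) (F : X -> Y) (x0 xdag : X) (hxdag : U xdag)
  (K : {linear Xt -> Y}) (k : R) (hk0 : (0 < k)%R)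
  (hk : forall v, (`|K v| <= k * `|v|)%R)
  (r : X -> Xt) (hFK : forall x, U x -> (F x - F x0 = K (r x))%R)
  (hrinj : set_inj U r) (L : R) (hL0 : (0 < L)%R)
  (hL : forall u v, U u -> U v -> (`|r u - r v| <= L * `|u - v|)%R)
  (P : X -> X) (Xc : set X) (hIP : forall x, Xc (x - P x)%R)
  (hPxdag : P xdag = 0%R)
  (Rc : X -> \bar R) (hRc0 : forall x, Xc x -> 0 <= Rc x)
  (psi : R -> R) (b Rbar : R) (xi : X -> R) (hVSC : VSC Xc U F Rc xdag psi p b Rbar xi)
  (Reg : Xt -> \bar R)
  (hReg : forall rh, (r @` U) rh ->
     Reg rh = Rc (pinv U r rh - P (pinv U r rh))%R)
  (hRegy : forall rh, ~ (r @` U) rh -> Reg rh = +oo)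
  (Q : Xt -> Xt -> \bar R)
  (hQ0 : forall r1 r2, 0 <= Q r1 r2)
  (hQeq : forall r1 r2, Q r1 r2 = 0 <-> r1 = r2)
  (CQ : R) (hCQ : (0 < CQ)%R)
  (hQ : forall r1 r2, (r @` U) r1 -> (r @` U) r2 ->
     (`|P (pinv U r r1) - P (pinv U r r2)|%R)%:E <= CQ%:E * Q r1 r2)
  (beta : R) (hbeta : (0 < beta)%R).

Let c := defect_const p beta CQ k L.
Let cbeta := (beta^-1 `^ p^-1)%R.

Let p_gt0 : (0 < p)%R. Proof. exact: lt_le_trans hp. Qed.

Lemma pinv_rK x : U x -> pinv U r (r x) = x.
Proof. by move=> Ux; apply: pinvKV; rewrite ?inE. Qed.

Lemma tikhonov_exact (yd : Y) (alpha d : R) : (`|F xdag - yd| <= d)%R ->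
  tikhonov K (F x0) yd Reg Q P r p alpha beta (r xdag) xdag
    <= (d `^ p)%:E + alpha%:E * Rc xdag.
Proof.
move=> dle; rewrite /tikhonov.
have -> : Q (r xdag) (r xdag) = 0 by apply/hQeq.
rewrite hPxdag normr0 poweR0r ?gt_eqF// powR0 ?gt_eqF// mule0 !adde0.
rewrite hReg; last by exists xdag.
rewrite pinv_rK// hPxdag subr0 -hFK// subrK leeD2r// lee_fin.
by rewrite ge0_ler_powR ?nnegrE ?(le_trans _ dle)// ltW.
Qed.

(** F (u - P u) - F xdag is the residual at r u, plus the data noise, plus
    K (r (u - P u) - r u).  The arguments of r in the last term differ by P u,
    and P u differs from P x by at most CQ Q(r x, r u). *)
Lemma defect_bound (x : X) (u : X) (q d : R) (yd : Y) :
  U x -> U u -> U (u - P u)%R -> (`|F xdag - yd| <= d)%R ->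
  Q (r x) (r u) = q%:E ->
  (`|F (u - P u) - F xdag|
     <= `|K (r u) + F x0 - yd| + d + k * L * (CQ * q + `|P x|))%R.
Proof.
move=> Ux Uu Uc dle Qq.
have -> : (F (u - P u) - F xdag =
    K (r u) + F x0 - yd - (F xdag - yd) + K (r (u - P u) - r u))%R.
  have -> : K (r (u - P u) - r u)%R = (F (u - P u) - F x0 - K (r u))%R.
    by rewrite hFK// linearB.
  rewrite opprB subrKA -[(F _ - F x0 - _)%R]addrA -opprD.
  by rewrite [(F x0 + _)%R]addrC [RHS]addrC subrKA.
apply: (le_trans (ler_normD _ _)); apply: lerD.
  by apply: (le_trans (ler_normB _ _)); rewrite lerD2l.
apply: (le_trans (hk _)); rewrite -mulrA ler_pM2l//.
apply: (le_trans (hL Uc Uu)); rewrite ler_pM2l//.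
rewrite addrAC subrr sub0r normrN.
have := hQ (imageP r Ux) (imageP r Uu).
rewrite Qq !pinv_rK// -EFinM lee_fin => h.
rewrite -[P u](subrK (P x)) (le_trans (ler_normD _ _))// lerD2r.
by rewrite distrC.
Qed.

Lemma defect_powR_bound (x u : X) (q d : R) (yd : Y) :
  U x -> U u -> U (u - P u)%R -> (`|F xdag - yd| <= d)%R ->
  Q (r x) (r u) = q%:E -> (0 <= q)%R ->
  (`|F (u - P u) - F xdag| `^ p <=
   c `^ p * (`|K (r u) + F x0 - yd| `^ p + beta * q `^ p + `|P x| `^ p
             + d `^ p))%R.
Proof.
move=> Ux Uu Uc dle Qq q0.
have d0 : (0 <= d)%R := le_trans (normr_ge0 _) dle.
set res := (`|K (r u) + F x0 - yd|)%R; set T := (_ + d `^ p)%R.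
have [res_s q_s m_s d_s] := le_powR_sum p_gt0 hbeta
  (normr_ge0 (K (r u) + F x0 - yd)%R) q0 (normr_ge0 (P x)) d0.
rewrite -/T in res_s q_s m_s d_s.
have T0 : (0 <= T)%R by rewrite !addr_ge0 ?powR_ge0// mulr_ge0 ?powR_ge0// ltW.
have c0 : (0 <= c)%R by rewrite ltW// defect_const_gt0.
have -> : (c `^ p * T = (c * T `^ p^-1) `^ p)%R.
  by rewrite powRM ?powR_ge0// powR_invK.
rewrite ge0_ler_powR ?nnegrE ?mulr_ge0 ?powR_ge0 ?(ltW p_gt0)//.
apply: (le_trans (defect_bound Ux Uu Uc dle Qq)).
rewrite -/res /c /defect_const mulrDl (_ : 2 * _ = T `^ p^-1 + T `^ p^-1)%R; last by ring.
rewrite !lerD// -[leRHS]mulrA ler_wpM2l ?mulr_ge0 ?(ltW hk0) ?(ltW hL0)//.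
by rewrite mulrDl mul1r lerD// -mulrA ler_wpM2l// ltW.
Qed.

(** The upper bound on the conjugate term is what places u - P u in the sublevel
    set of Rbar: minimality gives
    Rc (u - P u) - rho0 <= (1 + Ceta) d ^ p / alpha, and the lower bound on
    phi_inv alpha makes the right-hand side at most (1 + Ceta) / taul times the
    conjugate term. *)
Lemma near_minimizer_estimate (C Ceta taul tauu alpha d e rho0 : R) (yd : Y)
    (rh : Xt) (x : X) :
  (c `^ p <= C)%R -> (0 < Ceta)%R -> (0 < taul)%R ->
  (0 < alpha)%R -> (0 < d)%R -> (e <= Ceta * d `^ p)%R ->
  (`|F xdag - yd| <= d)%R -> U x -> Rc xdag = rho0%:E ->
  (taul * d `^ p)%:E <= phi_inv psi C alpha <= (tauu * d `^ p)%:E ->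
  conjugate (oppext psi) (- (1 / (2 * C * alpha)))%R
     <= (taul * (Rbar - rho0) / (1 + Ceta))%:E ->
  tikhonov K (F x0) yd Reg Q P r p alpha beta rh x
    <= tikhonov K (F x0) yd Reg Q P r p alpha beta (r xdag) xdag + e%:E ->
  let A := (3 / 2 + Ceta + tauu)%R in
  let M := ((2 * A + 1) `^ p^-1)%R in
  exists D q : R, [/\
    bregman Rc xi (pinv U r rh - P (pinv U r rh))%R xdag = D%:E /\ (0 <= D)%R,
    (alpha * ((1 - b) * D) <= A * d `^ p)%R,
    (`|K (rh - r xdag)| <= (M + 1) * d)%R,
    (`|P x| <= M * d)%R &
    [/\ Q (r x) rh = q%:E, (0 <= q)%R & (q <= cbeta * M * d)%R]].
Proof.
move=> cC Ceta0 taul0 a0 d0 ele dle Ux Rxd /andP[phil phiu] Sle hmin A M.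
set S := conjugate _ _ in Sle.
have Xxd : Xc xdag by rewrite -(subr0 xdag) -{1}hPxdag; exact: hIP.
have Reg0 : 0 <= Reg rh.
  have [rhU|/hRegy->//] := pselect ((r @` U) rh).
  by rewrite hReg// hRc0.
have hB : tikhonov K (F x0) yd Reg Q P r p alpha beta rh x
    <= ((1 + Ceta) * d `^ p + alpha * rho0)%:E.
  apply: (le_trans hmin); apply: (le_trans (leeD2r _ (tikhonov_exact _ dle))).
  by rewrite Rxd -EFinM -!EFinD lee_fin; lra.
have [rho [q [Rr rho_ge0 Qq q0 sumB]]] := tikhonov_finite p_gt0 a0 hbeta Reg0 (hQ0 _ _) hB.
(* Reg is infinite off r @` U, so its finiteness yields the preimage u *)
have [u Uu ru] : (r @` U) rh.
  by apply: contrapT => /hRegy; rewrite Rr.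
subst rh.
have c0 : (0 < c)%R by exact: defect_const_gt0.
have cp0 : (0 < c `^ p)%R by exact: powR_gt0.
have C0 := lt_le_trans cp0 cC.
have dp0 : (0 < d `^ p)%R by exact: powR_gt0.
rewrite hReg in Rr; last by exists u.
rewrite pinv_rK// in Rr *.
set T := (`|K (r u) + F x0 - yd| `^ p + beta * q `^ p + `|P x| `^ p)%R.
have T0 : (0 <= T)%R by rewrite !addr_ge0 ?powR_ge0// mulr_ge0 ?powR_ge0// ltW.
have TB : (T + alpha * (rho - rho0) <= (1 + Ceta) * d `^ p)%R.
  by rewrite /T; lra.
have [S' SE] : exists S' : R, S = S'%:E.
  move: phil phiu Sle; rewrite /phi_inv -/S; case: S => [S' _ _ _|//|].
  - by exists S'.
  - by rewrite gt0_muleNy ?lte_fin// leeNy_eq.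
move: phil phiu Sle; rewrite /phi_inv -/S SE -EFinM !lee_fin => phil phiu Sle.
have rhoR : (rho <= Rbar)%R.
  rewrite -(lerD2r (- rho0)) -(ler_pM2l a0).
  have h1 : (alpha * (rho - rho0) <= (1 + Ceta) * d `^ p)%R by lra.
  apply: (le_trans h1).
  have Ceta1 : (0 < 1 + Ceta)%R by lra.
  rewrite -(ler_pM2l taul0) mulrCA.
  apply: (@le_trans _ _ ((1 + Ceta) * (alpha * S'))%R); first by rewrite ler_pM2l.
  move: Sle; rewrite ler_pdivlMr// => /(ler_wpM2l (ltW a0)); lra.
have Xc' : Xc (u - P u)%R by exact: hIP.
have [D [DE D0 Uc' hD]] := VSC_bregman hVSC Xc' Rr Rxd rhoR.
have hN := defect_powR_bound Ux Uu Uc' dle Qq q0.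
rewrite -/T in hN.
have hY : (psi (`|F (u - P u) - F xdag| `^ p) <=
    `|F (u - P u) - F xdag| `^ p / (2 * C * alpha) + S')%R.
  rewrite -lee_fin EFinD -SE; apply: young_conjugate; exact: powR_ge0.
have est := absorb a0 cp0 cC T0 (ltW dp0) TB hD hY hN phiu.
have b1 : (0 < 1 - b)%R by case: hVSC => /andP[_ b1] _ _ _; rewrite subr_gt0.
have aD : (0 <= alpha * ((1 - b) * D))%R by rewrite !mulr_ge0// ltW.
have A0 : (0 <= 2 * A + 1)%R.
  have := le_trans (ltW (mulr_gt0 taul0 dp0)) (le_trans phil phiu).
  by rewrite pmulr_lge0// /A; lra.
have [res_s q_s m_s d_s] := le_powR_sum p_gt0 hbeta
  (normr_ge0 (K (r u) + F x0 - yd)%R) q0 (normr_ge0 (P x)) (ltW d0).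
rewrite -/T in res_s q_s m_s d_s.
have sM : ((T + d `^ p) `^ p^-1 <= M * d)%R.
  have -> : (M * d = ((2 * A + 1) * d `^ p) `^ p^-1)%R.
    by rewrite powRM ?powR_ge0// -[in RHS]powRrM mulfV ?gt_eqF// powRr1// ltW.
  apply: ge0_ler_powR; rewrite ?nnegrE ?invr_ge0 ?(ltW p_gt0)//.
  - by rewrite addr_ge0// ltW.
  - by rewrite mulr_ge0// ltW.
  - by move: est aD; rewrite -/A; lra.
exists D, q; split => //.
- by rewrite /A; lra.
- have -> : K (r u - r xdag)%R = ((K (r u) + F x0 - yd) - (F xdag - yd))%R.
    by rewrite linearB -(hFK hxdag) !opprB subrKA addrA.
  apply: (le_trans (ler_normB _ _)); rewrite mulrDl mul1r lerD//.
  exact: le_trans res_s sM.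
- exact: le_trans m_s sM.
- split => //; apply: (le_trans q_s); rewrite -mulrA ler_wpM2l// powR_ge0//.
Qed.

End Estimate.

Unset Implicit Arguments.

Theorem theorem3 (R : realType) (X Xt Y : completeNormedModType R) (p : R)
    (hp : (1 <= p)%R)
    (DF U : set X) (F : X -> Y) (hUDF : U `<=` DF)
    (x0 xdag : X) (y : Y) (hx0 : U x0) (hxdag : U xdag) (hy : F xdag = y)
    (* range invariance *)
    (K : {linear Xt -> Y}) (hK : continuous K)
    (r : X -> Xt) (hFK : forall x, U x -> (F x - F x0 = K (r x))%R)
    (hrinj : set_inj U r) (hrlip : [lipschitz r x | x in U])
    (* the operator P and the subspace Xc *)
    (P : X -> X) (Xc : set X) (hXc : submod_closed [in Xc])
    (hPXc : forall x, Xc x -> P x = 0%R)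
    (hIP : forall x, Xc (x - P x)%R)
    (hPxdag : P xdag = 0%R) (hPx0 : P x0 = 0%R)
    (* the functional on Xc and the variational source condition *)
    (Rc : X -> \bar R) (hRc0 : forall x, Xc x -> 0 <= Rc x)
    (hRcproper : proper_on Xc Rc)
    (psi : R -> R) (hpsia : index_function (fun t => (psi t)%:E))
    (cpsi : R) (hcpsi : (0 < cpsi)%R)
    (hpsib : forall t : R, (0 < t)%R -> (cpsi * t <= psi t)%R)
    (hpsic : conjugate_condition psi)
    (b Rbar : R) (xi : X -> R) (hVSC : VSC Xc U F Rc xdag psi p b Rbar xi)
    (* the functionals Reg and Q *)
    (Reg : Xt -> \bar R)
    (hReg : forall rh, (r @` U) rh ->
       Reg rh = Rc (pinv U r rh - P (pinv U r rh))%R)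
    (hRegy : forall rh, ~ (r @` U) rh -> Reg rh = +oo)
    (Q : Xt -> Xt -> \bar R)
    (hQ0 : forall r1 r2, 0 <= Q r1 r2)
    (hQeq : forall r1 r2, Q r1 r2 = 0 <-> r1 = r2)
    (CQ : R) (hCQ : (0 < CQ)%R)
    (hQ : forall r1 r2, (r @` U) r1 -> (r @` U) r2 ->
       (`|P (pinv U r r1) - P (pinv U r r2)|%R)%:E <= CQ%:E * Q r1 r2)
    (* fixed constants *)
    (beta Ceta taul tauu : R) (hbeta : (0 < beta)%R) (hCeta : (0 < Ceta)%R)
    (htaul : (0 < taul)%R) (htau : (taul < tauu)%R) :
  exists2 Cbar0 : R, (0 < Cbar0)%R &
  forall Cbar : R, (Cbar0 <= Cbar)%R ->
  forall (dbar : R) (ydelta : R -> Y) (alpha eta : R -> R)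
    (rhat : R -> Xt) (xd : R -> X),
  (0 < dbar)%R ->
  (forall d : R, (0 < d)%R -> (d <= dbar)%R ->
     [/\ (`|y - ydelta d| <= d)%R,
         (0 < alpha d)%R,
         (0 < eta d)%R,
         (eta d <= Ceta * d `^ p)%R &
         (taul * d `^ p)%:E <= phi_inv psi Cbar (alpha d)
           <= (tauu * d `^ p)%:E]) ->
  (forall d : R, (0 < d)%R -> (d <= dbar)%R ->
     U (xd d) /\
     forall (rh : Xt) (x : X), U x ->
       tikhonov K (F x0) (ydelta d) Reg Q P r p (alpha d) beta (rhat d) (xd d)
       <= tikhonov K (F x0) (ydelta d) Reg Q P r p (alpha d) beta rh x
          + (eta d)%:E) ->
  [/\ ebigO 0%R^'+
        (fun d => bregman Rc xi
           (pinv U r (rhat d) - P (pinv U r (rhat d)))%R xdag)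
        (fun d => psi_tilde psi Cbar tauu (d `^ p)%R),
      (fun d : R => K (rhat d - r xdag)%R) =O_ (0%R^'+) (fun d : R => d : R^o),
      (fun d : R => P (xd d)) =O_ (0%R^'+) (fun d : R => d : R^o) &
      ebigO 0%R^'+ (fun d => Q (r (xd d)) (rhat d)) (fun d => d%:E)].

Proof.
have p0 : (0 < p)%R by exact: lt_le_trans hp.
have [k k0 hk] := linear_bound_ex_gt0 hK.
have [L L0 hL] := lipschitz_ex_gt0 hrlip.
have [/andP[b0 b1] Rxd_lt _ _] := hVSC.
have Xxd : Xc xdag by rewrite -(subr0 xdag) -{1}hPxdag; exact: hIP.
have [rho0 Rxd] : exists rho0 : R, Rc xdag = rho0%:E.
  by case: (Rc xdag) (hRc0 _ Xxd) Rxd_lt => // rho _ _; exists rho.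
have rho0R : (rho0 < Rbar)%R by rewrite -lte_fin -Rxd.
set c := defect_const p beta CQ k L.
have cp0 : (0 < c `^ p)%R by apply: powR_gt0; exact: defect_const_gt0.
exists (c `^ p)%R => // Cbar cC dbar ydelta alpha eta rhat xd dbar0 data near_min.
have C0 := lt_le_trans cp0 cC.
(* the threshold required by near_minimizer_estimate *)
set e := (taul * (Rbar - rho0) / (1 + Ceta))%R.
have e0 : (0 < e)%R by rewrite divr_gt0 ?mulr_gt0 ?subr_gt0// addr_gt0.
have [m1 m10 small] := psistar_small_of_phi_inv hpsic C0 e0.
have [m2 m20 lephi] := le_phi hpsic C0.
set A := (3 / 2 + Ceta + tauu)%R.
set M := ((2 * A + 1) `^ p^-1)%R.
have tauu0 := lt_trans htaul htau.
have A0 : (0 < A)%R by rewrite !addr_gt0// divr_gt0.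
have M0 : (0 <= M)%R by exact: powR_ge0.
set cb := (beta^-1 `^ p^-1)%R.
have rates : \forall d \near (0%R : R)^'+, exists D q : R,
   [/\ (0 < d)%R,
    `|bregman Rc xi (pinv U r (rhat d) - P (pinv U r (rhat d)))%R xdag| <=
     (A / (taul * (1 - b)))%:E * `|psi_tilde psi Cbar tauu (d `^ p)%R|,
    (`|K (rhat d - r xdag)| <= (M + 1) * d)%R,
    (`|P (xd d)| <= M * d)%R &
    `|Q (r (xd d)) (rhat d)| <= (cb * M)%:E * `|d%:E|].
  near=> d.
  have d0 : (0 < d)%R by near: d; exact: nbhs_right_gt.
  have dd : (d <= dbar)%R by near: d; exact: nbhs_right_le.
  have [dy a0 _ etale philu] := data d d0 dd.
  have [Uxd hmin] := near_min d d0 dd.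
  have /andP[phil phiu] := philu.
  have a20 : (0 < 2 * Cbar * alpha d)%R by rewrite !mulr_gt0.
  have Se : psistar psi (2 * Cbar * alpha d) < e%:E.
    apply: small => //; apply: (le_lt_trans phiu); rewrite lte_fin.
    by near: d; exact: near_powR_lt.
  have dp0 : (0 < d `^ p)%R by exact: powR_gt0.
  have aphi : (alpha d <= phi psi Cbar (tauu * d `^ p))%R.
    apply: lephi => //; last exact: ltW.
    rewrite mulr_ge0 ?ltW//=.
    by near: d; exact: near_powR_lt.
  have := near_minimizer_estimate hp hxdag k0 hk hFK hrinj L0 hL hIP hPxdag hRc0
    hVSC hReg hRegy hQ0 hQeq hCQ hQ hbeta cC hCeta htaul a0 d0 etale _ Uxd Rxd philu.
  rewrite hy conjugateE// => /(_ _ _ dy (ltW Se) (hmin _ _ hxdag)).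
  rewrite -/A -/M => -[D [q [[DE D0] aD Kd Pd [Qq q0 qd]]]].
  exists D, q; split => //.
    rewrite DE gee0_abs ?lee_fin//.
    set S := psistar psi (2 * Cbar * alpha d).
    have S_ge0 : 0 <= S by apply: psistar_ge0 => //; exact: ltW.
    have Sfin : S \is a fin_num.
      by rewrite ge0_fin_numE// (lt_trans Se) ?ltry.
    apply: (@le_trans _ _ ((A / (taul * (1 - b)))%:E * S)).
      rewrite -(fineK Sfin) -EFinM lee_fin.
      have b1' : (0 < 1 - b)%R by rewrite subr_gt0.
      rewrite mulrAC ler_pdivlMr ?mulr_gt0// -(ler_pM2l a0).
      move: phil; rewrite phi_invE// -/S -(fineK Sfin) -EFinM lee_fin => phil.
      have := ler_wpM2l (ltW htaul) aD; have := ler_wpM2l (ltW A0) phil; lra.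
    have A'0 : (0 <= A / (taul * (1 - b)))%R.
      by rewrite divr_ge0 ?mulr_ge0 ?subr_ge0 ?ltW.
    apply: lee_wpmul2l; first by rewrite lee_fin.
    apply: (le_trans _ (lee_abs _)); rewrite /psi_tilde conjugateE; last first.
      by rewrite !mulr_gt0// (lt_le_trans a0).
    apply: psistar_le => //; first exact: ltW.
    by rewrite ler_pM2l// mulr_gt0.
  by rewrite Qq !gee0_abs ?lee_fin ?(ltW d0).
split.
- exists (A / (taul * (1 - b)))%R.
  by apply: filterS rates => d [D [q []]].
- apply/eqO_exP; exists (M + 1)%R; first by rewrite ltr_wpDl.
  apply: filterS rates => d [D [q [d0 _ Kd _ _]]].
  by rewrite (gtr0_norm d0).
- apply/eqO_exP; exists (M + 1)%R; first by rewrite ltr_wpDl.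
  apply: filterS rates => d [D [q [d0 _ _ Pd _]]].
  rewrite (gtr0_norm d0) (le_trans Pd)// ler_pM2r//; lra.
- exists (cb * M)%R; by apply: filterS rates => d [D [q []]].
Unshelve. all: by end_near. Qed.
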